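(* Let $(X,T)$ be a minimal system, $x\in X$, and let $U$ be an open neighborhood of $x$. Put $S=\{n\in\mathbb Z:T^nx\in U\}$. Then for each integer $d\ge1$ the set $$\{(n_1,\dots,n_d)\in\mathbb Z^d:\ n_1\epsilon_1+\cdots+n_d\epsilon_d\in S\ \text{ for all }(\epsilon_1,\dots,\epsilon_d)\in\{0,1\}^d\}$$ is syndetic in $\mathbb Z^d$.
   Context: A system $(X,T)$ is a compact metric space $X$ with a homeomorphism $T:X\to X$; it is minimal if every orbit $\{T^nx:n\in\mathbb Z\}$ is dense. A subset $A\subset\mathbb Z^d$ is syndetic if there is a finite set $F\subset\mathbb Z^d$ with $A+F=\mathbb Z^d$. *)

(* Defs.v *)
From HB Require Import structures.
From mathcomp Require Import all_boot all_order all_algebra.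
From mathcomp Require Import all_classical all_reals all_analysis.

Set Implicit Arguments.
Unset Strict Implicit.
Unset Printing Implicit Defensive.

Import Order.TTheory GRing.Theory Num.Theory.
Local Open Scope classical_set_scope.
Local Open Scope ring_scope.

Record homeomorphism (X : topologicalType) := Homeomorphism {
  homeo_fun :> X -> X;
  homeo_inv : X -> X;
  homeo_funK : cancel homeo_fun homeo_inv;
  homeo_invK : cancel homeo_inv homeo_fun;
  homeo_fun_continuous : continuous homeo_fun;
  homeo_inv_continuous : continuous homeo_inv }.

(* [Negz k] is the integer - k.+1. *)
Definition iterz (X : topologicalType) (T : homeomorphism X) (n : int) : X -> X :=
  match n with
  | Posz k => iter k T
  | Negz k => iter k.+1 (homeo_inv T)
  end.

Definition orbitz (X : topologicalType) (T : homeomorphism X) (x : X) : set X :=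
  [set iterz T n x | n in [set: int]].

Definition minimal_system (X : topologicalType) (T : homeomorphism X) : Prop :=
  forall x : X, dense (orbitz T x).

Definition syndetic (d : nat) (A : set 'rV[int]_d) : Prop :=
  exists2 F : set 'rV[int]_d, finite_set F &
    [set a + f | a in A & f in F] = [set: 'rV[int]_d].

Definition return_times (X : topologicalType) (T : homeomorphism X) (x : X)
    (U : set X) : set int :=
  [set n : int | U (iterz T n x)].

Definition cube_set (S : set int) (d : nat) : set 'rV[int]_d :=
  [set n : 'rV[int]_d | forall eps : {ffun 'I_d -> bool},
     S (\sum_(i < d) n 0 i * (eps i)%:Z)].

Arguments cube_set S d : clear implicits.

(* Main.v *)
(* Let E be the enveloping semigroup of (X, T). By minimality of X, a minimal left
   ideal of E contains an idempotent p with p x = x. Let Z^d act on the points of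
   X indexed by {0,1}^d, the vector n acting by T^(n . eps) on the coordinate eps.
   The enveloping semigroup of this action contains, for each i, the family equal
   to p where eps_i = 1 and to the identity elsewhere; since p p = p, the product
   of these is the family q equal to p at every eps other than 0. As q is an
   idempotent minimal in every coordinate, it lies in a minimal left ideal. So the
   diagonal point over x, which q fixes, is uniformly recurrent under Z^d, and its
   return times to the cube of U are the required set. *)
Require Import Defs.
From HB Require Import structures.
From mathcomp Require Import all_boot all_order all_algebra.
From mathcomp Require Import all_classical all_reals all_analysis.

Set Implicit Arguments.
Unset Strict Implicit.
Unset Printing Implicit Defensive.

Import Order.TTheory GRing.Theory Num.Theory.
Local Open Scope classical_set_scope.
Local Open Scope ring_scope.

(** * Minimal closed sets in a compact set *)

(** Zorn's lemma runs over open sets [W] not covering [A0]; the minimal set is [A0] minus a maximal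
    [W]. Stability of [Q] under intersections fits subsemigroups and left ideals alike. *)
Lemma compact_minimal_closed (M : topologicalType) (Q : set (set M))
    (A0 : set M) : compact A0 -> closed A0 -> A0 !=set0 -> Q A0 ->
    (forall C, C `<=` Q -> Q (\bigcap_(A in C) A)) ->
  exists A, [/\ A `<=` A0, closed A, A !=set0, Q A &
    forall B, B `<=` A -> closed B -> B !=set0 -> Q B -> B = A].
Proof.
move=> cptA0 clA0 A0n0 QA0 Qcap.
have QI A B : Q A -> Q B -> Q (A `&` B).
  move=> QA QB; rewrite -bigcap2inE; set D := bigcap2 A B.
  rewrite [X in Q X](_ : _ = \bigcap_(C in D @` `I_2) C).
    by apply: Qcap => _ [[|[|//]] _ <-].
  by rewrite bigcap_image.
pose P (W : set M) := [/\ closed (~` W), A0 `\` W !=set0 & Q (~` W)].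
have [F FP Ftot|W [[clW WA0 QW] Wmax]] := @Zorn_bigcup M P.
  split.
  - rewrite setC_bigcup; apply: closed_bigI => W FW.
    by have [] := FP _ FW.
  - have [->|/set0P[W0 FW0]] := eqVneq F set0.
      by rewrite bigcup_set0 setD0.
    (* As [F] is a chain, the sets [A0] minus [W] form a filter base; a cluster point in [A0] avoids
       every [W]. *)
    have PF : ProperFilter (filter_from F (fun W => A0 `\` W)).
      apply: filter_from_proper; last by move=> W /FP[].
      apply: filter_from_filter; first by exists W0.
      move=> V W FV FW; have [VW|WV] := Ftot _ _ FV FW.
        by exists W => // y [A0y nWy]; split; split => // /VW.
      by exists V => // y [A0y nVy]; split; split => // /WV.
    have [|y [A0y cly]] := cptA0 _ PF.
      by exists W0 => // y [].
    exists y; split => // -[W FW Wy].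
    have [clW _ _] := FP _ FW.
    apply: (clW y _) Wy => B nB.
    have [|z [[_ nWz] Bz]] := cly (A0 `\` W) B _ nB; first by exists W.
    by exists z.
  - rewrite setC_bigcup.
    rewrite [X in Q X](_ : _ = \bigcap_(A in (@setC M) @` F) A).
      by apply: Qcap => _ [W FW <-]; have [] := FP _ FW.
    by rewrite bigcap_image.
exists (A0 `\` W); split => //.
- exact: closedI.
- exact: QI.
move=> B BA clB Bn0 QB; apply/seteqP; split => // y [A0y nWy].
apply: contrapT => nBy; apply: (Wmax (~` B)).
  split; first by move=> z Wz /BA[].
  by move=> /(_ y nBy).
rewrite /P setCK; split => //.
by have [z Bz] := Bn0; exists z; split; [have [] := BA _ Bz|exact].
Qed.

(** * Idempotents and minimal left ideals in compact right topological semigroups *)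

Section CompactRightTopologicalSemigroup.
Variables (M : topologicalType) (mul : M -> M -> M).
Hypotheses (mulA : associative mul) (mul_cont : forall g, continuous (mul^~ g)).
Hypotheses (cptM : compact [set: M]) (hM : hausdorff_space M).

Let closed_compact (A : set M) : closed A -> compact A.
Proof. by move=> clA; apply: subclosed_compact cptM _. Qed.

Let closed_translate (A : set M) g : closed A -> closed (mul^~ g @` A).
Proof.
move=> clA; apply: compact_closed => //; apply: continuous_compact.
  exact/continuous_subspaceT/mul_cont.
exact: closed_compact.
Qed.

Let closed_stabilizer (A : set M) g h : closed A ->
  closed (A `&` [set f | mul f g = h]).
Proof.
move=> clA; apply: closedI => //.
rewrite [X in closed X](_ : _ = mul^~ g @^-1` [set h])//.
apply: preimage_closed; first by move=> ? _; exact: mul_cont.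
exact/accessible_closed_set1/hausdorff_accessible.
Qed.

Definition subsemigroup (A : set M) := forall f g, A f -> A g -> A (mul f g).

(** In a minimal closed subsemigroup [S] containing [p], the subsemigroup [S p] is all of [S]. So
    some [f] in [S] has [f p = p]; such [f] form a closed subsemigroup, again all of [S], which
    contains [p]. *)
Lemma ellis_idempotent (A : set M) : closed A -> A !=set0 -> subsemigroup A ->
  exists2 p, A p & mul p p = p.
Proof.
move=> clA An0 sA.
have [|S [SA clS [p Sp] sS Smin]] :=
    compact_minimal_closed (closed_compact clA) clA An0 sA.
  by move=> C CQ f g Cf Cg B CB; apply: (CQ _ CB); [exact: Cf|exact: Cg].
exists p; first exact: SA.
have pS : mul^~ p @` S = S.
  apply: Smin; [|exact: closed_translate|by exists (mul p p), p|].
    by move=> _ [f Sf <-]; exact: sS.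
  move=> _ _ [f Sf <-] [g Sg <-]; exists (mul (mul f p) g).
    exact: (sS _ _ (sS _ _ Sf Sp) Sg).
  by rewrite !mulA.
have pfix : S `&` [set f | mul f p = p] = S.
  apply: Smin; [by move=> f []|exact: closed_stabilizer| |].
    by move: Sp; rewrite -{1}pS => -[f Sf fp]; exists f.
  move=> f g [Sf fp] [Sg gp]; split; first exact: sS.
  by rewrite /= -mulA gp.
by move: Sp; rewrite -{1}pfix => -[].
Qed.

Definition left_ideal (E L : set M) := forall f g, E f -> L g -> L (mul f g).

(** Testing against closed ideals loses nothing when [E] is a closed subsemigroup: a left ideal
    containing [g] contains the closed left ideal [E g]. *)
Definition minimal_left_ideal (E L : set M) :=
  [/\ L `<=` E, closed L, L !=set0, left_ideal E L &
    forall K, K `<=` L -> closed K -> K !=set0 -> left_ideal E K -> K = L].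

Lemma exists_minimal_left_ideal (E A : set M) : A `<=` E -> closed A ->
    A !=set0 -> left_ideal E A ->
  exists2 L, minimal_left_ideal E L & L `<=` A.
Proof.
move=> AE clA An0 iA.
have [|L [LA clL Ln0 iL Lmin]] :=
    compact_minimal_closed (closed_compact clA) clA An0 iA.
  by move=> C CQ f g Ef Cg B CB; apply: (CQ _ CB) => //; exact: Cg.
by exists L => //; split => //; apply: subset_trans AE.
Qed.

Lemma left_ideal_translate (E : set M) g : subsemigroup E -> closed E ->
  closed (mul^~ g @` E) /\ left_ideal E (mul^~ g @` E).
Proof.
move=> sE clE; split; first exact: closed_translate.
by move=> f _ Ef [h Eh <-]; exists (mul f h); [exact: sE|rewrite mulA].
Qed.

(** [E g] is a closed left ideal inside [L], so minimality makes it [L]. *)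
Lemma minimal_left_ideal_generated (E L : set M) g h : subsemigroup E ->
    closed E -> minimal_left_ideal E L -> L g -> L h ->
  exists2 f, E f & mul f g = h.
Proof.
move=> sE clE [LE _ _ iL Lmin] Lg Lh.
have [clEg iEg] := left_ideal_translate g sE clE.
have EgL : mul^~ g @` E = L.
  apply: Lmin => //; first by move=> _ [f Ef <-]; exact: iL.
  by exists (mul g g), g => //; exact: LE.
by move: Lh; rewrite -EgL => -[f Ef fg]; exists f.
Qed.

(** Write [p = f v]; then [p v = f v v = f v = p]. *)
Lemma minimal_idempotent_absorb (E L : set M) p v : subsemigroup E ->
    closed E -> minimal_left_ideal E L -> L p -> L v -> mul v v = v ->
  mul p v = p.
Proof.
move=> sE clE mL Lp Lv vv.
have [f Ef <-] := minimal_left_ideal_generated sE clE mL Lv Lp.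
by rewrite -mulA vv.
Qed.

End CompactRightTopologicalSemigroup.

(** * Continuity into products and passage to limits *)

Lemma continuous_prod_topology (Y : topologicalType) (I : Type)
    (K : I -> topologicalType) (f : Y -> prod_topology K) :
  (forall i, continuous (fun y => f y i)) -> continuous f.
Proof.
move=> cf y; apply/cvg_sup => i U [V [[W oW <-] Wfy] WU].
by apply: (filterS WU); apply: cf; exact: open_nbhs_nbhs.
Qed.

(** This carries properties checked on powers of [T] to the whole enveloping semigroup. *)
Lemma closure_preimage (M N : topologicalType) (f : M -> N) (D : set M)
    (C : set N) :
  continuous f -> closed C -> D `<=` f @^-1` C -> closure D `<=` f @^-1` C.
Proof.
move=> cf clC DC; rewrite closureE; apply: smallest_sub => //.
by apply: preimage_closed => // y _; exact: cf.
Qed.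

(** * Integer powers of a homeomorphism *)

Section IntegerPowers.
Variables (X : topologicalType) (T : homeomorphism X).

Lemma iterz_succ n y : iterz T (n + 1) y = T (iterz T n y).
Proof.
(* The exponent -1 stands apart: adding 1 to it leaves the constructor [Negz]. *)
case: n => [n|[|n]].
- by rewrite -PoszD addn1.
- by rewrite NegzE addNr /= homeo_invK.
- by rewrite [iterz T (Negz _) y]/= homeo_invK NegzE -[n.+2]addn1 PoszD opprD addrNK -NegzE.
Qed.

Lemma iterz_pred n y : iterz T (n - 1) y = homeo_inv T (iterz T n y).
Proof. by rewrite -[in RHS](subrK 1 n) iterz_succ homeo_funK. Qed.

Lemma iterzD m n y : iterz T (m + n) y = iterz T m (iterz T n y).
Proof.
elim/int_ind: m => [|m IH|m IH]; first by rewrite add0r.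
- by rewrite intS addrC [1 + _]addrC addrA [n + _]addrC !iterz_succ IH.
- by rewrite intS opprD addrC [- 1 + _]addrC addrA [n + _]addrC !iterz_pred IH.
Qed.

Lemma iterz_continuous n : continuous (iterz T n).
Proof.
have itc (S : X -> X) : continuous S -> forall k, continuous (iter k S).
  move=> cS; elim=> [|k IH] y; first exact: cvg_id.
  by apply: (@continuous_comp _ _ _ (iter k S) S); [exact: IH|exact: cS].
case: n => n /=; apply: itc; first exact: homeo_fun_continuous.
exact: homeo_inv_continuous.
Qed.

End IntegerPowers.

(** * Enveloping semigroups of families of powers *)

Section EnvelopingSemigroup.
Variables (X : topologicalType) (T : homeomorphism X).
Hypotheses (cptX : compact [set: X]) (hX : hausdorff_space X).

(* J-indexed families of self-maps of X, uncurried so that Tychonoff's theorem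
   applies as it stands. *)
Definition self_maps (J : choiceType) : topologicalType :=
  prod_topology (fun _ : J * X => X).

Definition comp_maps (J : choiceType) (f g : self_maps J) : self_maps J :=
  fun a => f (a.1, g a).

Definition power_maps (J : choiceType) (k : J -> int) : self_maps J :=
  fun a => iterz T (k a.1) a.2.

(** For [J := unit] and [A := setT] this is the Ellis semigroup of [(X, T)]; a smaller [A] restricts
    which exponents may occur together. *)
Definition enveloping (J : choiceType) (A : set (J -> int)) :
    set (self_maps J) :=
  closure (@power_maps J @` A).

Lemma eval_continuous (J : choiceType) a :
  continuous (fun f : self_maps J => f a).
Proof. exact: (@proj_continuous _ (fun _ : J * X => X) a). Qed.

Lemma comp_mapsA (J : choiceType) : associative (@comp_maps J).
Proof. by []. Qed.

Lemma comp_maps_continuous (J : choiceType) (g : self_maps J) :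
  continuous (fun f => comp_maps f g).
Proof. by apply: continuous_prod_topology => a; exact: eval_continuous. Qed.

(** Left translation by a power of [T] is continuous because the power is; a limit of powers need
    not be. *)
Lemma comp_power_continuous (J : choiceType) (k : J -> int) :
  continuous (comp_maps (power_maps k)).
Proof.
apply: continuous_prod_topology => a f.
apply: (@continuous_comp _ _ _ (fun f : self_maps J => f a)).
  exact: eval_continuous.
exact: iterz_continuous.
Qed.

Lemma self_maps_compact (J : choiceType) : compact [set: self_maps J].
Proof.
have := @tychonoff _ (fun _ : J * X => X) (fun=> setT) (fun=> cptX).
by congr compact; apply/seteqP; split.
Qed.

Lemma self_maps_hausdorff (J : choiceType) : hausdorff_space (self_maps J).
Proof. exact: (@hausdorff_product _ (fun _ : J * X => X) (fun=> hX)). Qed.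

Lemma power_mapsD (J : choiceType) (k l : J -> int) :
  comp_maps (power_maps k) (power_maps l) = power_maps (fun j => k j + l j).
Proof. by apply/funext => a; rewrite /comp_maps /power_maps/= iterzD. Qed.

Lemma enveloping_power (J : choiceType) (A : set (J -> int)) k :
  A k -> enveloping A (power_maps k).
Proof. by move=> Ak; apply: subset_closure; exists k. Qed.

Lemma enveloping_closed (J : choiceType) (A : set (J -> int)) :
  closed (enveloping A).
Proof. exact: closed_closure. Qed.

(** Limits are taken one factor at a time: first in [f], by continuity of right translations, then
    in [g], once [f] is a power. *)
Lemma enveloping_subsemigroup (J : choiceType) (A : set (J -> int)) :
  (forall k l, A k -> A l -> A (fun j => k j + l j)) ->
  subsemigroup (@comp_maps J) (enveloping A).
Proof.
move=> AD f g Ef Eg.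
suff : enveloping A `<=` (fun f => comp_maps f g) @^-1` enveloping A by apply.
apply: closure_preimage; [exact: comp_maps_continuous|exact: closed_closure|].
move=> _ [k Ak <-] /=.
suff : enveloping A `<=` comp_maps (power_maps k) @^-1` enveloping A by apply.
apply: closure_preimage; [exact: comp_power_continuous|exact: closed_closure|].
by move=> _ [l Al <-] /=; rewrite power_mapsD; apply: enveloping_power; exact: AD.
Qed.

Definition coordinate (J : choiceType) (j : J) (f : self_maps J) :
    self_maps unit :=
  fun a => f (j, a.2).

Lemma enveloping_coordinate (J : choiceType) (A : set (J -> int)) j f :
  enveloping A f -> enveloping [set: unit -> int] (coordinate j f).
Proof.
suff : enveloping A `<=` coordinate j @^-1` enveloping setT by apply.
apply: closure_preimage; last 2 first.
- exact: closed_closure.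
- by move=> _ [k Ak <-]; apply: (@enveloping_power _ _ (fun=> k j)).
by apply: continuous_prod_topology => a; exact: eval_continuous.
Qed.

Definition spread (J : choiceType) (b : pred J) (p : self_maps unit) :
    self_maps J :=
  fun a => if b a.1 then p (tt, a.2) else a.2.

Lemma spread_continuous (J : choiceType) (b : pred J) : continuous (spread b).
Proof.
apply: continuous_prod_topology => a; rewrite /spread.
case: (b a.1); first exact: eval_continuous.
exact: cst_continuous.
Qed.

(** Spreading the k-th power gives exponent [k] on [b] and 0 elsewhere, a family in [A]; [spread b]
    is continuous. *)
Lemma enveloping_spread (J : choiceType) (A : set (J -> int)) (b : pred J) p :
  (forall k : int, A (fun j => if b j then k else 0)) ->
  enveloping setT p -> enveloping A (spread b p).
Proof.
move=> Ab.
suff : enveloping setT `<=` spread b @^-1` enveloping A by apply.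
apply: closure_preimage; [exact: spread_continuous|exact: closed_closure|].
move=> _ [k _ <-] /=.
rewrite [X in enveloping A X](_ : _ =
    power_maps (fun j => if b j then k tt else 0)).
  exact/enveloping_power/Ab.
by apply/funext => -[j y]; rewrite /spread /power_maps/=; case: ifP.
Qed.

Lemma enveloping_fixed (J : choiceType) (A : set (J -> int)) j f y :
  (forall k, A k -> k j = 0) -> enveloping A f -> f (j, y) = y.
Proof.
move=> A0.
suff : enveloping A `<=` (fun f : self_maps J => f (j, y)) @^-1` [set y].
  by apply.
apply: closure_preimage; first exact: eval_continuous.
  exact/accessible_closed_set1/hausdorff_accessible.
by move=> _ [k Ak <-]; rewrite /power_maps/= (A0 _ Ak).
Qed.

(** * Idempotents in minimal left ideals and uniform recurrence *)

(** The set [L x] is closed and contains the dense orbit of [g x], hence [x]. The elements of [L]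
    fixing [x] thus form a nonempty closed subsemigroup, which has an idempotent. *)
Lemma minimal_ideal_idempotent_fixing (x : X) : minimal_system T ->
  exists L p, [/\ minimal_left_ideal (@comp_maps unit) (enveloping setT) L,
    L p, comp_maps p p = p & p (tt, x) = x].
Proof.
move=> minT; set E := enveloping _.
have sE : subsemigroup (@comp_maps unit) E by exact: enveloping_subsemigroup.
have clE : closed E by exact: enveloping_closed.
have [||L mL _] := @exists_minimal_left_ideal _ (@comp_maps unit)
  (@self_maps_compact _) E E (@subset_refl _ _) clE.
- by exists (power_maps (fun=> 0)); exact: enveloping_power.
- exact: sE.
have [LE clL [g Lg] iL _] := mL.
pose ev (f : self_maps unit) := f (tt, x).
have clLx : closed (ev @` L).
  apply: compact_closed => //; apply: continuous_compact.
    exact/continuous_subspaceT/eval_continuous.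
  exact: subclosed_compact clL (@self_maps_compact _) _.
have [f Lf fx] : (ev @` L) x.
  apply: contrapT => nLx.
  have [||y [nLy [n _ ny]]] := minT (ev g) (~` (ev @` L)).
  - by exists x.
  - exact: closed_openC.
  rewrite -ny in nLy; apply: nLy.
  exists (comp_maps (power_maps (fun=> n)) g) => //.
  by apply: iL => //; exact: enveloping_power.
have [|||p [Lp px] pp] := @ellis_idempotent _ (@comp_maps unit)
  (@comp_mapsA _) (@comp_maps_continuous _) (@self_maps_compact _)
  (@self_maps_hausdorff _) (L `&` ev @^-1` [set x]).
- apply: closedI => //; apply: preimage_closed.
    by move=> ? _; exact: eval_continuous.
  exact/accessible_closed_set1/hausdorff_accessible.
- by exists f.
- move=> u v [Lu ux] [Lv vx]; split; first exact: iL (LE _ Lu) Lv.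
  by rewrite /= /ev /comp_maps/= [v _]vx.
by exists L, p.
Qed.

(* A minimal left ideal K inside E q contains an idempotent v, and v q = v.
   Hence each nontrivial coordinate of v lies in L, where p = w v_j for some w,
   so p v_j = p. Thus q = q v belongs to K. *)
Lemma spread_minimal_left_ideal (J : choiceType) (A : set (J -> int))
    (b : pred J) (L : set (self_maps unit)) p :
  (forall k l, A k -> A l -> A (fun j => k j + l j)) ->
  (forall k j, A k -> ~~ b j -> k j = 0) ->
  minimal_left_ideal (@comp_maps unit) (enveloping setT) L ->
  L p -> comp_maps p p = p -> enveloping A (spread b p) ->
  exists2 K, minimal_left_ideal (@comp_maps J) (enveloping A) K
    & K (spread b p).
Proof.
move=> AD A0 mL Lp pp; set q := spread b p; set E := enveloping A => Eq.
have sE : subsemigroup (@comp_maps J) E by exact: enveloping_subsemigroup.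
have clE : closed E by exact: enveloping_closed.
have [clEq iEq] := left_ideal_translate (@comp_mapsA J) (@comp_maps_continuous J)
  (@self_maps_compact J) (@self_maps_hausdorff J) q sE clE.
have [||K mK KEq] := @exists_minimal_left_ideal _ (@comp_maps J)
  (@self_maps_compact _) E (_ @` E) _ clEq _ iEq.
- by move=> _ [f Ef <-]; exact: sE.
- by exists (comp_maps q q), q.
have [KE clK Kn0 iK _] := mK.
have [v Kv vv] : exists2 v, K v & comp_maps v v = v.
  apply: (@ellis_idempotent _ (@comp_maps J)) => //.
  - exact: comp_maps_continuous.
  - exact: self_maps_compact.
  - exact: self_maps_hausdorff.
  by move=> f g Kf Kg; apply: iK => //; exact: KE.
exists K => //; suff -> : q = comp_maps q v by exact: iK.
apply/funext => -[j y]; rewrite /comp_maps/=.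
have [bj|nbj] := boolP (b j); last first.
  (* Off [b] all exponents vanish, so [v] is the identity there. *)
  by rewrite (enveloping_fixed _ (fun k Ak => A0 k j Ak nbj) (KE _ Kv)).
have [w Ew wq] := KEq _ Kv.
(* From [v = w q], the coordinate of [v] at [j] is that of [w] composed with [p]. *)
have vL : L (coordinate j v).
  rewrite -wq (_ : coordinate j _ = comp_maps (coordinate j w) p).
    by have [_ _ _ iL _] := mL; apply: iL => //; exact: enveloping_coordinate Ew.
  by apply/funext => -[[] z]; rewrite /coordinate /comp_maps/= /q /spread/= bj.
have : comp_maps p (coordinate j v) = p.
  apply: (@minimal_idempotent_absorb _ _ (@comp_mapsA _)
    (@comp_maps_continuous _) (@self_maps_compact _) (@self_maps_hausdorff _)
    (enveloping setT) L) => //.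
  - exact: enveloping_subsemigroup.
  - exact: enveloping_closed.
  by apply/funext => -[[] z]; exact: (congr1 (fun f : self_maps J => f (j, z)) vv).
move=> /(congr1 (fun f : self_maps unit => f (tt, y))).
by rewrite /q /spread/= bj => <-.
Qed.

(** Each [f] in [K] satisfies [g f = q] for some [g], so a power close to [g] takes [f], and its
    neighbours, into [O]. Compactness of [K] leaves finitely many powers. *)
Lemma minimal_left_ideal_returns (J : finType) (I : countType)
    (k : I -> J -> int) (K : set (self_maps J)) (q : self_maps J)
    (O : set (self_maps J)) :
  subsemigroup (@comp_maps J) (enveloping (range k)) ->
  minimal_left_ideal (@comp_maps J) (enveloping (range k)) K ->
  K q -> open O -> O q ->
  exists2 F : set I, finite_set F & forall f, K f ->
    exists2 n, F n & O (comp_maps (power_maps (k n)) f).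
Proof.
move=> sE mK Kq oO Oq.
have [_ clK _ _ _] := mK.
(* Finiteness is expressed by a bound on [pickle n], so that compactness applies as near covering
   along [\oo]. *)
pose Q (N : nat) (f : self_maps J) :=
  exists2 n, (pickle n <= N)%N & O (comp_maps (power_maps (k n)) f).
have : compact K by exact: subclosed_compact clK (@self_maps_compact _) _.
rewrite compact_near_coveringP => /(_ nat \oo Q _)[f Kf|N _ QN].
  have [g Eg gf] := minimal_left_ideal_generated (@comp_mapsA J)
    (@comp_maps_continuous J) (@self_maps_compact J) (@self_maps_hausdorff J)
    sE (@enveloping_closed _ _) mK Kf Kq.
  have cO : open ((fun h => comp_maps h f) @^-1` O).
    by apply: open_comp => // h _; exact: comp_maps_continuous.
  have [|_ [[_ [n _ <-] <-] On]] := Eg ((fun h => comp_maps h f) @^-1` O).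
    by apply: open_nbhs_nbhs; split => //=; rewrite gf.
  exists (comp_maps (power_maps (k n)) @^-1` O, [set N | (pickle n <= N)%N]).
    split => /=; last exact: nbhs_infty_ge.
    apply: open_nbhs_nbhs; split => //.
    by apply: open_comp => // h _; exact: comp_power_continuous.
  by move=> [h N] [/= Oh nN]; exists n.
exists [set n | (pickle n <= N)%N].
  rewrite (_ : [set n | _] = pickle @^-1` `I_N.+1) //.
  by apply: finite_preimage => // m n _ _; exact: (pcan_inj pickleK).
by move=> f Kf; have [|n] := QN N _ f Kf => //=; exists n.
Qed.

End EnvelopingSemigroup.

(** * Exponents indexed by the vertices of the cube *)

Section CubeIndices.
Variable d : nat.
Implicit Types (n m : 'rV[int]_d) (eps : {ffun 'I_d -> bool}).

Definition cube_index n eps : int := \sum_(i < d) n 0 i * (eps i)%:Z.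

Lemma cube_indexD n m :
  cube_index (n + m) = fun eps => cube_index n eps + cube_index m eps.
Proof.
apply/funext => eps; rewrite /cube_index -big_split/=.
by apply: eq_bigr => i _; rewrite mxE mulrDl.
Qed.

Lemma cube_index_rangeD (k l : {ffun 'I_d -> bool} -> int) :
  range cube_index k -> range cube_index l ->
  range cube_index (fun eps => k eps + l eps).
Proof. by move=> [n _ <-] [m _ <-]; exists (n + m); rewrite ?cube_indexD. Qed.

(** Multiples of a basis vector provide the exponents that [enveloping_spread] asks for on the face
    where [eps i] holds. *)
Lemma cube_index_delta i (c : int) :
  cube_index (c *: delta_mx 0 i) = fun eps => if eps i then c else 0.
Proof.
apply/funext => eps; rewrite /cube_index (bigD1 i)//= big1 => [|j ji].
  by rewrite !mxE !eqxx addr0 mulr1; case: (eps i); rewrite ?mulr1 ?mulr0.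
by rewrite !mxE (negPf ji) andbF mulr0 mul0r.
Qed.

Lemma cube_index0 : cube_index 0 = fun=> 0.
Proof.
by apply/funext => eps; apply: big1 => i _; rewrite mxE mul0r.
Qed.

End CubeIndices.

(** * Syndeticity of the cube return set *)

Theorem proposition7p1 (R : realType) (X : metricType R)
    (cptX : compact [set: X]) (T : homeomorphism X) (minT : minimal_system T)
    (x : X) (U : set X) (xU : open_nbhs x U) (d : nat) (d_ge1 : (1 <= d)%N) :
  syndetic (cube_set (return_times T x U) d).
Proof.
have hX : hausdorff_space X := @metric_hausdorff R X.
have [oU Ux] := xU.
have [L [p [mL Lp pp px]]] := minimal_ideal_idempotent_fixing cptX hX x minT.
pose J : finType := {ffun 'I_d -> bool}.
pose E := enveloping T (range (@cube_index d)).
have sE : subsemigroup (@comp_maps X J) E.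
  by apply: enveloping_subsemigroup; exact: cube_index_rangeD.
(* The predicate holds exactly at nonzero [eps]; its list form allows induction over the factors of
   [q]. *)
pose q := @spread X J (fun eps => has eps (enum 'I_d)) p.
have Ep : enveloping T setT p by have [LE _ _ _ _] := mL; exact: LE.
have Eq : E q.
  rewrite /q; elim: (enum 'I_d) => [|i s IH].
    apply: (enveloping_spread _ Ep) => k; exists 0 => //; exact: cube_index0.
  rewrite [X in E X](_ : _ = comp_maps (@spread X J (fun eps => eps i) p)
      (@spread X J (fun eps => has eps s) p)).
    apply: sE IH; apply: (enveloping_spread _ Ep) => k.
    by exists (k *: delta_mx 0 i) => //; exact: cube_index_delta.
  apply/funext => -[eps y]; rewrite /comp_maps /spread/=.
  (* Where both factors act, the composite is [p p = p]. *)
  have ppy := congr1 (fun f : self_maps X unit => f (tt, y)) pp.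
  by case: (eps i); case: (has eps s).
have [|k eps [n _ <-] neps|K mK Kq] :=
    spread_minimal_left_ideal cptX hX _ _ mL Lp pp Eq.
- exact: cube_index_rangeD.
- apply: big1 => i _; case: (boolP (eps i)) => [ei|_]; last by rewrite mulr0.
  by case/hasP: neps; exists i; rewrite ?mem_enum.
pose O := [set f : self_maps X J | forall eps, U (f (eps, x))].
(* Only finitely many vertices [eps] impose a condition. *)
have oO : open O.
  rewrite openE => f Of.
  have FF : Filter (nbhs f) by exact: nbhs_filter.
  apply: (@filter_forall _ J (fun eps g => U (g (eps, x))) (nbhs f) FF) => eps.
  apply: (@eval_continuous X J (eps, x) f U).
  by apply: open_nbhs_nbhs; split => //; exact: Of.
have qx eps : q (eps, x) = x by rewrite /q /spread/=; case: ifP.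
have Oq : O q by move=> eps; rewrite qx.
have [F finF FK] := minimal_left_ideal_returns cptX hX sE mK Kq oO Oq.
(* If [n] carries [m] into the set, then [m = (n + m) + (- n)]; hence the sign. *)
exists (-%R @` F); first exact: finite_image.
apply/seteqP; split => // m _.
have [KE _ _ iK _] := mK.
(* The translate of [q] by [m] stays in [K], and as [q] fixes [x] at every vertex, its value over
   [x] at [eps] is the power of [T] with exponent [cube_index m eps] applied to [x]. *)
have [n Fn On] : exists2 n, F n &
    O (comp_maps (power_maps T (cube_index n))
      (comp_maps (power_maps T (cube_index m)) q)).
  by apply: FK; apply: iK => //; apply: enveloping_power; exists m.
exists (n + m); last by exists (- n); [exists n|rewrite addrC addKr].
move=> eps; have := On eps.
rewrite comp_mapsA power_mapsD -cube_indexD /comp_maps /power_maps/= qx.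
exact.
Qed.
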